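(* Let $G$ be a connected graph and let $H$ be an arbitrary graph (both finite, undirected, simple, with at least two vertices). The lexicographic product $G[H]$ is identifiable if and only if (i) $H$ is identifiable and $\Delta(H)\leq |V(H)|-2$, or (ii) both $G$ and $H$ are identifiable.
   Context: All graphs are finite, undirected, simple, with at least two vertices. $V(\Gamma)$ is the vertex set of a graph $\Gamma$, $d_\Gamma(u,v)$ is the distance in $\Gamma$ (infinite if $u,v$ lie in different components), and $\Delta(\Gamma)$ is the maximum degree. For $v\in V(\Gamma)$, $B_\Gamma(v)=\{u\in V(\Gamma): d_\Gamma(u,v)\leq 1\}$ (closed neighbourhood). A code is a nonempty set of vertices. A code $C$ covers $v$ if $B_\Gamma(v)\cap C\neq\emptyset$; it separates two distinct vertices $x,y$ if $B_\Gamma(x)\cap C\neq B_\Gamma(y)\cap C$. An identifying code of $\Gamma$ is a code that covers every vertex of $\Gamma$ and separates every pair of distinct vertices of $\Gamma$. $\Gamma$ is identifiable if it admits at least one identifying code. The lexicographic product $G[H]$ has vertex set $V(G)\times V(H)$, with $(u_1,v_1)$ and $(u_2,v_2)$ adjacent if and only if $d_G(u_1,u_2)=1$, or $u_1=u_2$ and $d_H(v_1,v_2)=1$. *)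

(* Defs.v *)
From mathcomp Require Import all_boot.

Set Implicit Arguments.
Unset Strict Implicit.
Unset Printing Implicit Defensive.

Record sgraph := SGraph {
  vertex :> finType;
  adj : rel vertex;
  adj_sym : symmetric adj;
  adj_irrefl : irreflexive adj
}.

Section Distance.
Variable G : sgraph.
Implicit Types x y : G.

Definition walk (n : nat) x y : bool :=
  [exists p : n.-tuple G, path (@adj G) x p && (last x p == y)].

(* [None] stands for infinity. Searching the lengths below [#|G|] is enough:
   see [dist_SomeP] and [dist_NoneP]. *)
Definition dist x y : option nat :=
  let n := find (fun k => walk k x y) (iota 0 #|G|) in
  if n < #|G| then Some n else None.

Lemma walkP n x y :
  reflect (exists p, [/\ path (@adj G) x p, last x p = y & size p = n])
          (walk n x y).
Proof.
apply: (iffP existsP) => [[p /andP[pp /eqP lp]]|[p [pp lp sp]]].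
  by exists p; rewrite size_tuple.
have sp' : size p == n by apply/eqP.
by exists (Tuple sp'); rewrite /= pp lp eqxx.
Qed.

Lemma connect_walk x y :
  connect (@adj G) x y -> exists2 n, n < #|G| & walk n x y.
Proof.
case/connectP=> p pp ->; case/shortenP: pp => p' pp' up' _.
exists (size p'); last by apply/walkP; exists p'.
by rewrite -[(size p').+1]/(size (x :: p')) -(card_uniqP up') max_card.
Qed.

Lemma walk_connect n x y : walk n x y -> connect (@adj G) x y.
Proof. by case/walkP=> p [pp lp _]; apply/connectP; exists p. Qed.

Lemma has_walkE x y :
  has (fun k => walk k x y) (iota 0 #|G|) = connect (@adj G) x y.
Proof.
apply/hasP/idP => [[n _ /walk_connect //]|/connect_walk[n ltn wn]].
by exists n; rewrite // mem_iota.
Qed.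

Lemma dist_NoneP x y : dist x y = None <-> ~~ connect (@adj G) x y.
Proof.
rewrite /dist -has_walkE has_find size_iota.
by case: ifP.
Qed.

Lemma dist_SomeP n x y :
  dist x y = Some n <-> walk n x y /\ (forall m, walk m x y -> n <= m).
Proof.
have spec k : dist x y = Some k ->
    walk k x y /\ (forall m, walk m x y -> k <= m).
  rewrite /dist; case: ifP => // ltk [<-].
  have hw : has (fun k => walk k x y) (iota 0 #|G|).
    by rewrite has_find size_iota.
  split; first by have := nth_find 0 hw; rewrite nth_iota.
  move=> m wm; rewrite leqNgt; apply/negP => ltm.
  by have := before_find 0 ltm; rewrite nth_iota ?add0n ?wm // (ltn_trans ltm).
split=> [/spec //|[wn minn]].
case dE: (dist x y) => [k|].
  have [wk mink] := spec k dE.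
  by congr Some; apply/eqP; rewrite eqn_leq mink // minn.
by move/dist_NoneP: dE; rewrite (walk_connect wn).
Qed.

Lemma dist_eq0 x y : (dist x y == Some 0) = (x == y).
Proof.
apply/eqP/eqP => [/dist_SomeP[/walkP[p [_ lp /size0nil p0]] _]|<-].
  by rewrite p0 in lp.
by apply/dist_SomeP; split=> //; apply/walkP; exists [::].
Qed.

Lemma dist_eq1 x y : (dist x y == Some 1) = adj x y.
Proof.
apply/eqP/idP => [/dist_SomeP[/walkP[[|z [|t p]] [] //=]]|xy].
  by rewrite andbT => xz <-.
apply/dist_SomeP; split; first by apply/walkP; exists [:: y]; rewrite /= xy.
case=> // /walkP[p [_ lp /size0nil p0]].
by move: xy; rewrite -lp p0 /= adj_irrefl.
Qed.

End Distance.

Section Codes.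
Variable G : sgraph.
Implicit Types (v x y : G) (C : {set G}).

Definition ball v : {set G} :=
  [set u | if dist u v is Some d then d <= 1 else false].

Definition covers C v : bool := ball v :&: C != set0.

Definition separates C x y : bool := ball x :&: C != ball y :&: C.

Definition identifying_code C : Prop :=
  [/\ C != set0,
      forall v, covers C v
    & forall x y, x != y -> separates C x y].

Definition identifiable : Prop := exists C, identifying_code C.

Definition connected : Prop := forall x y, connect (@adj G) x y.

Definition degree v : nat := #|[set u | adj v u]|.

Definition max_degree : nat := \max_(v : G) degree v.

Lemma in_ball u v : (u \in ball v) = (u == v) || adj u v.
Proof.
rewrite inE -dist_eq0 -dist_eq1.
by case: (dist u v) => [[|[|d]]|].
Qed.

End Codes.

Section Lexicographic.
Variables G H : sgraph.

Definition lex_adj : rel (G * H)%type :=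
  [rel p q | (dist p.1 q.1 == Some 1)
             || (p.1 == q.1) && (dist p.2 q.2 == Some 1)].

Lemma lex_adj_sym : symmetric lex_adj.
Proof.
move=> p q; rewrite /lex_adj /= !dist_eq1 (adj_sym p.1) (adj_sym p.2).
by rewrite (eq_sym p.1).
Qed.

Lemma lex_adj_irrefl : irreflexive lex_adj.
Proof. by move=> p; rewrite /lex_adj /= !dist_eq1 !adj_irrefl andbF. Qed.

Definition lex_product : sgraph := SGraph lex_adj_sym lex_adj_irrefl.

End Lexicographic.

(* Main.v *)
Require Import Defs.
From mathcomp Require Import all_boot.
From Corelib Require Import Setoid.

(** The whole vertex set is the best possible code: it always covers, and it
    separates two vertices as soon as any code does.  So a graph is
    identifiable exactly when it has no twins, that is, when the closed
    neighbourhood map [ball] is injective ([identifiableP]).  The theorem is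
    then a comparison of the twins of G[H] with those of G and H.

    The ball of (u, v) consists of the full fibres over the neighbours of u,
    together with the copy of [ball v] in the fibre over u.  Two vertices in
    the same fibre are therefore twins in G[H] exactly when their second
    coordinates are twins in H ([ball_lex_fibre]).  Two twins (u, v), (u', v')
    in different fibres are adjacent, so u and u' are adjacent; the ball of
    (u, v) then contains the whole fibre over u', so v' dominates H, and
    symmetrically for v; over the remaining fibres the balls agree exactly when
    u and u' are twins in G ([ball_lex_across]).

    Hence G[H] is twin-free iff H is, and moreover G is twin-free or no vertex
    dominates H.  Since the ball of v has one element more than its
    neighbourhood, the absence of a dominating vertex is the degree bound
    ([max_degree_no_dominating]). *)

Lemma ball_refl (K : sgraph) (x : K) : x \in ball x.
Proof. by rewrite in_ball eqxx. Qed.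

(** Enlarging a code never destroys covering or separation, so only the code
    consisting of all vertices needs to be considered. *)
Lemma identifiableP (K : sgraph) (K_gt0 : 0 < #|K|) :
  identifiable K <-> injective (@ball K).
Proof.
split=> [[C [_ _ sepC]] x y eq_xy | inj].
  apply/eqP/negPn/negP => /sepC.
  by rewrite /separates eq_xy eqxx.
exists setT; split=> [|x|x y].
- by rewrite -card_gt0 cardsT.
- by rewrite /covers setIT; apply/set0Pn; exists x; apply: ball_refl.
- by rewrite /separates !setIT; apply: contraNneq => /inj ->.
Qed.

Lemma card_ball (K : sgraph) (v : K) : #|ball v| = (degree v).+1.
Proof.
have -> : ball v = v |: [set u | adj v u].
  by apply/setP => u; rewrite in_ball !inE adj_sym.
by rewrite cardsU1 inE adj_irrefl.
Qed.

Lemma max_degree_no_dominating (K : sgraph) (K_ge2 : 1 < #|K|) :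
  max_degree K <= #|K| - 2 <-> forall v : K, ball v != setT.
Proof.
have bound (v : K) : (degree v <= #|K| - 2) = (ball v != setT).
  rewrite -properT properEcard subsetT cardsT card_ball /=.
  by rewrite -(leq_add2r 2) subnK // addn2.
split=> [/bigmax_leqP le_deg v | no_dom].
  by rewrite -bound le_deg.
by apply/bigmax_leqP => v _; rewrite bound.
Qed.

Lemma in_ball_lex (G H : sgraph) (u a : G) (v b : H) :
  (((a, b) : lex_product G H) \in ball ((u, v) : lex_product G H))
  = adj a u || (a == u) && (b \in ball v).
Proof.
have adj_lexE : @adj (lex_product G H) (a, b) (u, v)
    = adj a u || (a == u) && adj b v by rewrite -(dist_eq1 a) -(dist_eq1 b).
rewrite !in_ball adj_lexE xpair_eqE.
by case: (adj a u) => /=; rewrite ?orbT // -andb_orr.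
Qed.

Lemma ball_lex_fibre (G H : sgraph) (u : G) (v v' : H) :
  ball ((u, v) : lex_product G H) = ball ((u, v') : lex_product G H)
  <-> ball v = ball v'.
Proof.
split=> [eq_lex | eq_vv'].
  apply/setP => b; move/setP/(_ (u, b)): eq_lex.
  by rewrite !in_ball_lex adj_irrefl eqxx.
by apply/setP => -[a b]; rewrite !in_ball_lex eq_vv'.
Qed.

(** Twins in different fibres lie over adjacent vertices, because each one
    belongs to the ball of the other; each ball then fills the fibre of the
    other vertex, which is what forces both second coordinates to dominate. *)
Lemma ball_lex_across (G H : sgraph) (u u' : G) (v v' : H) (neq : u != u') :
  ball ((u, v) : lex_product G H) = ball ((u', v') : lex_product G H)
  <-> [/\ ball u = ball u', ball v = setT & ball v' = setT].
Proof.
split=> [/setP eq_lex | [/setP eq_uu' domv domv']].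
  have adj_uu' : adj u u'.
    have := ball_refl (lex_product G H) (u, v).
    by rewrite eq_lex in_ball_lex (negPf neq) orbF.
  have domv : ball v = setT.
    apply/setP => b; have := eq_lex (u, b).
    by rewrite !in_ball_lex adj_irrefl eqxx adj_uu' in_setT.
  have domv' : ball v' = setT.
    apply/setP => b; have := eq_lex (u', b).
    by rewrite !in_ball_lex adj_irrefl eqxx adj_sym adj_uu' in_setT /= => <-.
  split=> //; apply/setP => a; have := eq_lex (a, v).
  by rewrite !in_ball_lex domv domv' !in_setT !andbT !in_ball orbC => ->; rewrite orbC.
apply/setP => -[a b]; have := eq_uu' a.
by rewrite !in_ball_lex domv domv' !in_setT !andbT !in_ball orbC => ->; rewrite orbC.
Qed.

Theorem theorem3p1 (G H : sgraph)
    (G_ge2 : 1 < #|G|) (H_ge2 : 1 < #|H|) (G_conn : connected G) :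
  identifiable (lex_product G H) <->
    (identifiable H /\ max_degree H <= #|H| - 2) \/
    (identifiable G /\ identifiable H).
Proof.
have G_gt0 := ltnW G_ge2; have H_gt0 := ltnW H_ge2.
have GH_gt0 : 0 < #|lex_product G H| by rewrite card_prod muln_gt0 G_gt0.
rewrite !identifiableP // max_degree_no_dominating //.
split=> [inj | twin_free].
  have injH : injective (@ball H).
    case/card_gt0P: (G_gt0) => u _ v v' /(ball_lex_fibre G H u) /inj.
    by case.
  case: (boolP [exists v : H, ball v == setT]) => [/existsP[v /eqP domv] | no_dom].
    (* A dominating vertex of H lifts any twins of G to twins of G[H]. *)
    right; split=> // u u' eq_uu'; apply/eqP; apply: contraT => neq.
    have /inj[eq_u] : ball ((u, v) : lex_product G H) = ball ((u', v) : lex_product G H).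
      by apply/ball_lex_across.
    by rewrite eq_u eqxx in neq.
  left; split=> // v; apply: contra no_dom => domv.
  by apply/existsP; exists v.
have injH : injective (@ball H) by case: twin_free => -[].
case=> u v [u' v']; case: (eqVneq u u') => [<- /ball_lex_fibre/injH -> //| neq].
move/(ball_lex_across _ _ _ _ _ _ neq) => [eq_uu' domv _].
case: twin_free => [[_ /(_ v)] | [injG _]]; first by rewrite domv eqxx.
by move: neq; rewrite (injG _ _ eq_uu') eqxx.
Qed.
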